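(* Let $\{\mu_t\}_{t\ge0}$ be a weakly continuous $\rhd$-convolution semigroup with $\mu_0=\delta_0$, with associated pair $(\gamma,\tau)$. The following are equivalent: (1) there exists $t_0>0$ such that $\operatorname{supp}\mu_{t_0}$ is bounded below; (2) $\operatorname{supp}\mu_t$ is bounded below for all $0\le t<\infty$; (3) $\operatorname{supp}\tau$ is bounded below.
   Context: For a probability measure $\mu$ on $\mathbb{R}$, $G_\mu(z)=\int\frac{1}{z-x}d\mu(x)$ on $\mathbb{C}^+$ and $H_\mu=1/G_\mu$; the monotone convolution $\mu\rhd\nu$ is the unique probability measure with $H_{\mu\rhd\nu}=H_\mu\circ H_\nu$. A weakly continuous $\rhd$-convolution semigroup is a family $\{\mu_t\}_{t\ge0}$ of probability measures, weakly continuous in $t$, with $\mu_s\rhd\mu_t=\mu_{s+t}$. For such a semigroup with $\mu_0=\delta_0$ there is a unique pair $(\gamma,\tau)$, $\gamma\in\mathbb{R}$, $\tau$ positive finite, such that with $A(z)=-\gamma+\int\frac{1+xz}{x-z}d\tau(x)$ the maps $H_t:=H_{\mu_t}$ solve $\frac{d}{dt}H_t(z)=A(H_t(z))$, $H_0(z)=z$, on $\mathbb{C}\setminus\mathbb{R}$ (the associated pair). *)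

(* Defs.v *)
From HB Require Import structures.
From mathcomp Require Import all_boot all_order all_algebra.
From mathcomp Require Import all_classical all_reals all_analysis.
From mathcomp Require Import complex.
Set Implicit Arguments. Unset Strict Implicit. Unset Printing Implicit Defensive.
Import Order.TTheory GRing.Theory Num.Theory.
Import numFieldNormedType.Exports.
Local Open Scope classical_set_scope.
Local Open Scope ring_scope.

Section Defs.
Variable R : realType.
Local Notation C := R[i].

Definition cint (m : {measure set R -> \bar R}) (f : R -> C) : C :=
  Complex (Rintegral m setT (fun x => complex.Re (f x)))
          (Rintegral m setT (fun x => complex.Im (f x))).

(* Cauchy transform G_mu(z) = \int 1/(z - x) dmu(x)  (meaningful off R). *)
Definition cauchyG (mu : probability R R) (z : C) : C :=
  cint mu (fun x => (z - (x%:C)%C)^-1).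

Definition cauchyH (mu : probability R R) (z : C) : C := (cauchyG mu z)^-1.

Definition gen_A (gamma : R) (tau : {finite_measure set R -> \bar R}) (z : C) : C :=
  - (gamma%:C)%C + cint tau (fun x => (1 + (x%:C)%C * z) / ((x%:C)%C - z)).

Definition msupp (m : {measure set R -> \bar R}) : set R :=
  [set x | forall e : R, 0 < e -> (0 < m (ball x e))%E].

Definition bounded_below (A : set R) : Prop := exists b : R, forall x, A x -> b <= x.

Definition weakly_continuous (mu : R -> probability R R) : Prop :=
  forall f : R -> R, continuous f -> (exists M : R, forall x, `|f x| <= M) ->
    {within `[0, +oo[, continuous (fun t => Rintegral (mu t) setT f)}.

Definition monotone_semigroup (mu : R -> probability R R) : Prop :=
  forall s t : R, 0 <= s -> 0 <= t -> forall z : C, 0 < complex.Im z ->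
    cauchyH (mu (s + t)) z = cauchyH (mu s) (cauchyH (mu t) z).

(* g has derivative dg(t) at each t >= 0, one-sided at t = 0. *)
Definition deriv_on_nonneg (g dg : R -> R) : Prop :=
  forall t : R, 0 <= t ->
    (fun h => h^-1 * (g (t + h) - g t)) @ within (fun h => 0 <= t + h) (nbhs (0:R)^')
      --> dg t.

Definition associated_pair (mu : R -> probability R R) (gamma : R)
    (tau : {finite_measure set R -> \bar R}) : Prop :=
  forall z : C, complex.Im z != 0 ->
    cauchyH (mu 0) z = z /\
    deriv_on_nonneg (fun t => complex.Re (cauchyH (mu t) z))
                    (fun t => complex.Re (gen_A gamma tau (cauchyH (mu t) z))) /\
    deriv_on_nonneg (fun t => complex.Im (cauchyH (mu t) z))
                    (fun t => complex.Im (gen_A gamma tau (cauchyH (mu t) z))).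

End Defs.

(* Main.v *)
Require Import Defs.
From HB Require Import structures.
From mathcomp Require Import all_boot all_order all_algebra.
From mathcomp Require Import all_classical all_reals all_analysis.
From mathcomp Require Import measurable_realfun complex ring lra.
Set Implicit Arguments. Unset Strict Implicit. Unset Printing Implicit Defensive.
Import Order.TTheory GRing.Theory Num.Theory.
Import numFieldNormedType.Exports.
Local Open Scope classical_set_scope.
Local Open Scope ring_scope.

(* A finite measure m has no mass near a real point as soon as ∫ dm(s)/|x+iy-s|^2 stays
   bounded for y -> 0, locally in x: then m(ball x y) = O(y^2), and the distribution
   function has derivative 0.  Write H_t = H_{mu_t}.

   If supp tau is bounded below by b, then, as long as Re H_t <= b - 1, the generator obeys
   Re A(H_t) <= -K Re H_t and Im A(H_t) <= L Im H_t; by Gronwall a trajectory starting at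
   x + iy with x far to the left stays to the left of b - 1 up to time t, and
   Im H_t(x+iy) <= exp(L t) y, which bounds ∫ dmu_t(s)/|x+iy-s|^2 = Im H_t / (y |H_t|^2).

   Conversely, let supp mu_{t0} be bounded below.  For w(s) = 1/(z-s), the ratio
   E|w|^2 / |E w|^2 = Im H_t(z) / Im z is nondecreasing in t, hence bounded for all t <= t0 and
   z near x, x far to the left.  Since mu_t concentrates at 0 when t -> 0, this forces E|w|^2
   to be bounded, so mu_t has no mass near x for small t.  Finally
     (1/t) ∫ s^2/|z-s|^2 dmu_t(s) -> Im A(z)/Im z = ∫ (1+s^2)/|z-s|^2 dtau(s)   (t -> 0+),
   and the left side at z = x + iy is dominated by its value at x + i, because mu_t has no
   mass near x; so tau has no mass near x either. *)

(** * Integrals of bounded measurable functions against a finite measure *)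

Section BoundedMeasurable.
Variable R : realType.
Implicit Types (f g : R -> R) (m : {finite_measure set R -> \bar R}) (D : set R).

Definition bmeas f := measurable_fun setT f /\ exists M : R, forall s, `|f s| <= M.

Lemma bmeas_cst (c : R) : bmeas (fun=> c).
Proof. by split; [exact: measurable_cst | exists `|c|]. Qed.

Lemma bmeasD f g : bmeas f -> bmeas g -> bmeas (fun s => f s + g s).
Proof.
move=> [mf [M Mf]] [mg [N Ng]]; split; first exact: (measurable_funD mf mg).
by exists (M + N) => s; rewrite (le_trans (ler_normD _ _))// lerD.
Qed.

Lemma bmeasZ (c : R) f : bmeas f -> bmeas (fun s => c * f s).
Proof.
move=> [mf [M Mf]]; split; first exact: (measurable_funM (measurable_cst c) mf).
by exists (`|c| * M) => s; rewrite normrM ler_wpM2l.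
Qed.

Lemma bmeas_integrable m f : bmeas f -> m.-integrable setT (EFin \o f).
Proof.
move=> [mf [M Mf]]; apply: measurable_bounded_integrable => //.
  by apply: fin_num_fun_lty; exact: fin_num_measure.
by exists M; split => [|x Mx s _ /=]; [exact: num_real | rewrite (le_trans (Mf s))// ltW].
Qed.

Lemma integral_bmeas_lc m (a b : R) f g : bmeas f -> bmeas g ->
  \int[m]_s (a * f s + b * g s) = a * \int[m]_s f s + b * \int[m]_s g s.
Proof.
move=> bf bg; rewrite RintegralD//.
- by rewrite !RintegralZl//; exact: bmeas_integrable.
- exact: (bmeas_integrable m (bmeasZ a bf)).
- exact: (bmeas_integrable m (bmeasZ b bg)).
Qed.

(** The inequality is asked only on a set of full measure, because several kernel comparisons below
    hold only on a ray, or off an interval, that carries the measure. *)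
Lemma le_integral_bmeas m D f g : measurable D -> m (~` D) = 0%E ->
  bmeas f -> bmeas g -> (forall s, D s -> f s <= g s) ->
  \int[m]_s f s <= \int[m]_s g s.
Proof.
move=> mD D0 bf bg fg.
have E h : bmeas h -> \int[m]_s h s = \int[m]_(s in D) h s.
  move=> bh; rewrite /Rintegral; congr fine.
  rewrite (negligible_integral (measurableC mD) _ (bmeas_integrable m bh))//.
  by rewrite setTD setCK.
rewrite !E//; apply: le_Rintegral => //.
  by apply: integrableS (bmeas_integrable m bf).
by apply: integrableS (bmeas_integrable m bg).
Qed.

Lemma integral_bmeas_gt0 m f : bmeas f -> (0 < m setT)%E -> (forall s, 0 < f s) ->
  0 < \int[m]_s f s.
Proof.
move=> bf m0 f0; rewrite lt_neqAle Rintegral_ge0 ?andbT => [|s _]; last exact: ltW.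
apply/eqP => I0.
have fi := bmeas_integrable m bf.
have /ae_eq_integral_abs : (\int[m]_(s in setT) `|(EFin \o f) s| = 0)%E.
  rewrite -[RHS]/(0%:E) I0 /Rintegral fineK; last exact: integrable_fin_num fi.
  by apply: eq_integral => s _ /=; rewrite gtr0_norm.
case=> //; first by case: bf => mf _; exact/measurable_EFinP.
move=> N [mN N0 sub]; have NT : N = setT.
  apply/seteqP; split=> // s _; apply: sub => /= /(_ I) [fs0].
  by have := f0 s; rewrite fs0 ltxx.
by move: m0; rewrite -NT N0 ltxx.
Qed.

End BoundedMeasurable.

(** * Real and imaginary parts of the Cauchy kernel *)

Section Kernels.
Variable R : realType.
Implicit Types (x y s : R) (m : {finite_measure set R -> \bar R}).

(* 1/(x + iy - s) = kerQ x y s - i y kerP x y s *)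
Definition kerP x y s : R := ((x - s) ^+ 2 + y ^+ 2)^-1.
Definition kerQ x y s : R := (x - s) * kerP x y s.

Lemma ker_denom_gt0 x y s : 0 < y -> 0 < (x - s) ^+ 2 + y ^+ 2.
Proof. by move=> y0; rewrite ltr_wpDl ?sqr_ge0// exprn_gt0. Qed.

Lemma kerP_gt0 x y s : 0 < y -> 0 < kerP x y s.
Proof. by move=> y0; rewrite invr_gt0 ker_denom_gt0. Qed.

Lemma kerPK x y s : 0 < y -> kerP x y s * ((x - s) ^+ 2 + y ^+ 2) = 1.
Proof. by move=> y0; rewrite mulVf// gt_eqF// ker_denom_gt0. Qed.

Lemma continuous_kerP x y : 0 < y -> continuous (kerP x y).
Proof.
move=> y0 s; rewrite /kerP; apply: cvgV; first by rewrite gt_eqF// ker_denom_gt0.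
apply: cvgD; last exact: cvg_cst.
rewrite expr2; under eq_fun do rewrite expr2.
by apply: cvgM; apply: cvgB => //; exact: cvg_cst.
Qed.

Lemma bmeas_kerP x y : 0 < y -> bmeas (kerP x y).
Proof.
move=> y0; split; first by apply: continuous_measurable_fun; exact: continuous_kerP.
exists (y ^+ 2)^-1 => s; rewrite gtr0_norm ?kerP_gt0//.
by rewrite /kerP lef_pV2 ?posrE ?ker_denom_gt0 ?exprn_gt0// lerDr sqr_ge0.
Qed.

Lemma bmeas_kerQ x y : 0 < y -> bmeas (kerQ x y).
Proof.
move=> y0; split.
  apply: continuous_measurable_fun => s; apply: cvgM; last exact: continuous_kerP.
  by apply: cvgB => //; exact: cvg_cst.
exists y^-1 => s; rewrite /kerQ normrM (gtr0_norm (kerP_gt0 _ _ y0)).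
rewrite ler_pdivrMr ?ker_denom_gt0// mulrDr.
rewrite -real_normK ?num_real//; set u := `|x - s|.
(* Completing the square gives [u <= (u^2 + y^2) / y]. *)
have -> : y^-1 * u ^+ 2 + y^-1 * y ^+ 2 = u + ((u - y / 2) ^+ 2 + 3 / 4 * y ^+ 2) / y.
  by field; rewrite gt_eqF.
rewrite lerDl; apply: divr_ge0; last exact: ltW.
by apply: addr_ge0; rewrite ?sqr_ge0// mulr_ge0 ?sqr_ge0//; lra.
Qed.

Definition kintP m x y := \int[m]_s kerP x y s.
Definition kintQ m x y := \int[m]_s kerQ x y s.

(* Every kernel integrated below has this shape, because s^2 = x^2 - y^2 - 2x(x-s) + |x+iy-s|^2. *)
Definition kerlc (a b c : R) x y s := a + b * kerP x y s + c * kerQ x y s.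

Lemma bmeas_kerlc a b c x y : 0 < y -> bmeas (kerlc a b c x y).
Proof.
move=> y0; apply: bmeasD; first apply: bmeasD; first exact: bmeas_cst.
  by apply: bmeasZ; exact: bmeas_kerP.
by apply: bmeasZ; exact: bmeas_kerQ.
Qed.

Lemma integral_kerlc m a b c x y : 0 < y ->
  \int[m]_s kerlc a b c x y s = a * fine (m setT) + b * kintP m x y + c * kintQ m x y.
Proof.
move=> y0; have bP := bmeas_kerP x y0; have bQ := bmeas_kerQ x y0.
have -> : \int[m]_s kerlc a b c x y s = 
    \int[m]_s (1 * (a * 1 + b * kerP x y s) + c * kerQ x y s).
  by apply: eq_Rintegral => s _; rewrite /kerlc mul1r mulr1.
rewrite integral_bmeas_lc// ?integral_bmeas_lc//; first by rewrite mul1r Rintegral_cst// mul1r.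
  exact: bmeas_cst.
apply: (@bmeasD R (fun=> a * 1)); first exact: bmeas_cst.
exact: bmeasZ.
Qed.

End Kernels.

(** * Mass of small balls, null intervals and supports *)

Section NullSets.
Variable R : realType.
Implicit Types (x y s : R) (m : {finite_measure set R -> \bar R}).

Definition quadratic_at m x :=
  exists C : R, forall y, 0 < y -> y < 1 -> fine (m (ball x y)) <= C * y ^+ 2.

Lemma fine_le_measure m (A B : set R) : measurable A -> measurable B ->
  A `<=` B -> fine (m A) <= fine (m B).
Proof.
by move=> mA mB AB; apply: fine_le; rewrite ?fin_num_measure// le_measure ?inE.
Qed.

Definition cdfm m x := fine (m `]-oo, x]%classic).

Lemma cdfmB m c d : c <= d -> cdfm m d - cdfm m c = fine (m `]c, d]%classic).
Proof.
move=> cd; rewrite /cdfm.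
have -> : `]-oo, d]%classic = `]-oo, c]%classic `|` `]c, d]%classic.
  by rewrite -itv_bndbnd_setU// bnd_simp.
rewrite measureU//= ?fineD ?fin_num_measure//; first by rewrite addrC addKr.
apply/seteqP; split => [s /= []|//]; rewrite !in_itv/= => sc /andP[cs _].
by move: (lt_le_trans cs sc); rewrite ltxx.
Qed.

Lemma is_derive_cdfm m x : quadratic_at m x -> is_derive x 1 (cdfm m) 0.
Proof.
move=> [C qC].
have C0 : 0 <= C.
  have h : (0 : R) < 1 / 2 by lra.
  have h' : (1 / 2 : R) < 1 by lra.
  have := le_trans (fine_ge0 (measure_ge0 m (ball x (1 / 2)))) (qC _ h h').
  by rewrite pmulr_lge0// exprn_gt0.
have bnd h : h != 0 -> `|h| < 1 / 2 ->
    `|h^-1 * (cdfm m (h + x) - cdfm m x)| <= 4 * C * `|h|.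
  move=> h0 h1; have ah0 : 0 < `|h| by rewrite normr_gt0.
  (* Balls are open, so radius [|h|] would miss the endpoint [x + h] when [h > 0]; the doubled
     radius catches it and stays below 1 because [|h| < 1/2]. *)
  have key : `|cdfm m (h + x) - cdfm m x| <= fine (m (ball x (2 * `|h|))).
    have [hp|hn] := leP 0 h.
      rewrite cdfmB ?lerDr// ger0_norm ?fine_ge0//; apply: fine_le_measure => //.
        exact: measurable_ball.
      move=> s /=; rewrite in_itv/= => /andP[xs sh]; rewrite /ball/= distrC.
      by rewrite gtr0_norm ?subr_gt0//; move: ah0; rewrite (ger0_norm hp); lra.
    rewrite distrC cdfmB; last by rewrite gerDr ltW.
    rewrite ger0_norm ?fine_ge0//; apply: fine_le_measure => //.
      exact: measurable_ball.
    move=> s /=; rewrite in_itv/= => /andP[xs sh]; rewrite /ball/=.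
    by rewrite ger0_norm ?subr_ge0//; move: ah0; rewrite (ltr0_norm hn); lra.
  rewrite normrM normfV ler_pdivrMl//; apply: (le_trans key).
  apply: (le_trans (qC _ _ _)); [lra|lra|].
  by rewrite le_eqVlt; apply/orP; left; apply/eqP; ring.
have cv : (fun h => h^-1 *: (cdfm m (h *: (1 : R) + x) - cdfm m x)) @ 0^' --> (0 : R).
  apply/cvgr0Pnorm_lt => e e0; near=> h.
  have h0 : h != 0 by near: h; exact: nbhs_dnbhs_neq.
  have hd : `|h| < Num.min (1 / 2) (e / (4 * C + 1)).
    near: h; apply: dnbhs0_lt; rewrite lt_min; apply/andP; split; first lra.
    by apply: divr_gt0 => //; lra.
  move: hd; rewrite lt_min => /andP[h1 h2].
  rewrite (_ : h *: 1 = h); last by rewrite /GRing.scale/= mulr1.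
  apply: (le_lt_trans (bnd _ h0 h1)).
  have c0 : 0 < 4 * C + 1 by lra.
  rewrite ltr_pdivlMr// in h2.
  apply: le_lt_trans h2; rewrite [leRHS]mulrC ler_wpM2r//; lra.
apply: DeriveDef; last exact/cvg_lim.
by apply/cvg_ex; exists 0.
Unshelve. all: by end_near.
Qed.

(** The mean value theorem applies to the distribution function, whose derivative vanishes on
    [[c, d]]. The constants in [quadratic_at] may vary with [x], so no covering argument is
    involved. *)
Lemma measure_itv_eq0 m c d : (forall x, c <= x <= d -> quadratic_at m x) ->
  m `]c, d]%classic = 0%E.
Proof.
move=> q; have [cd|dc] := leP c d; last by rewrite set_itv_ge ?measure0// bnd_simp -leNgt ltW.
have der x : c <= x <= d -> is_derive x 1 (cdfm m) 0.
  by move=> /q; exact: is_derive_cdfm.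
have der' x : x \in `]c, d[%R -> is_derive x 1 (cdfm m) 0.
  by rewrite in_itv/= => /andP[cx xd]; apply: der; rewrite !ltW.
have ct : {within `[c, d], continuous (cdfm m)}.
  apply: continuous_in_subspaceT => x /set_mem/=; rewrite in_itv/= => cxd.
  apply: differentiable_continuous; apply/derivable1_diffP.
  by have [] := der x cxd.
have [e _] := MVT_segment cd der' ct.
rewrite mul0r cdfmB// => m0.
by rewrite -[LHS]fineK ?m0// fin_num_measure.
Qed.

(** Chebyshev's argument: within distance [y] of [x] the kernel is at least [1 / (2 y^2)]. *)
Lemma ball_quadratic m x y : 0 < y ->
  fine (m (ball x y)) <= 2 * y ^+ 2 * kintP m x y.
Proof.
move=> y0; have mB := measurable_ball x y.
have -> : fine (m (ball x y)) = \int[m]_s (\1_(ball x y) s : R).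
  by rewrite /Rintegral integral_indic// setIT.
rewrite -RintegralZl//; last exact: bmeas_integrable (bmeas_kerP x y0).
apply: (@le_integral_bmeas R m setT) => //.
- by rewrite setCT measure0.
- split; first exact: measurable_indic.
  by exists 1 => s; rewrite indicE; case: (s \in (ball x y : set R)); rewrite /= ?normr1 ?normr0.
- by apply: bmeasZ; exact: bmeas_kerP.
move=> s _; rewrite indicE; have [xs|xs] := pselect (ball x y s); last first.
  rewrite memNset//.
  apply: mulr_ge0; last exact/ltW/kerP_gt0.
  by rewrite mulr_ge0// sqr_ge0.
rewrite mem_set//; move: xs; rewrite /ball/= => xs.
have d0 := ker_denom_gt0 x s y0; have y0' := ltW y0.
rewrite /kerP ler_pdivlMr// mul1r.
have : (x - s) ^+ 2 < y ^+ 2 by rewrite -real_normK ?num_real// ltr_pXn2r.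
by lra.
Qed.

Lemma quadratic_kintP m x : (exists C : R, forall y, 0 < y -> y < 1 -> kintP m x y <= C) ->
  quadratic_at m x.
Proof.
move=> [C hC]; exists (2 * C) => y y0 y1; apply: (le_trans (ball_quadratic m x y0)).
by rewrite mulrAC ler_wpM2r ?sqr_ge0// ler_wpM2l// hC.
Qed.

Lemma quadratic_ball0 m x e : 0 < e -> m (ball x e) = 0%E -> quadratic_at m x.
Proof.
(* For [y <= e] the ball is null; for [y > e] the factor [y^2 / e^2] exceeds 1, so the total mass
   suffices. *)
move=> e0 me0; exists (fine (m setT) / e ^+ 2) => y y0 y1.
have [ye|ey] := leP y e.
  have -> : m (ball x y) = 0%E.
    apply: (subset_measure0 _ _ _ me0); try exact: measurable_ball.
    exact: le_ball.
  by rewrite /= mulr_ge0 ?sqr_ge0// divr_ge0 ?sqr_ge0// fine_ge0.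
apply: (@le_trans _ _ (fine (m setT))).
  by apply: fine_le_measure => //; exact: measurable_ball.
rewrite mulrAC ler_pdivlMr ?exprn_gt0// ler_wpM2l ?fine_ge0//.
by rewrite ler_pXn2r ?nnegrE// ltW.
Qed.

Lemma notin_msupp m x : ~ msupp m x -> quadratic_at m x.
Proof.
move=> /existsNP[e] /not_implyP[e0 /negP].
rewrite -leNgt => me; apply: (quadratic_ball0 e0).
by apply/eqP; rewrite -measure_le0.
Qed.

Lemma measure_ray_eq0 m b : (forall x, x < b -> quadratic_at m x) ->
  forall a, a < b -> m (~` `[a, +oo[%classic) = 0%E.
Proof.
move=> q a ab; have -> : ~` `[a, +oo[%classic = `]-oo, a[%classic.
  by rewrite setCitvr.
apply: measure_negligible => //.
apply: (@negligibleS _ _ _ m (\bigcup_n `]a - n%:R, a]%classic)); last first.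
  apply: negligible_bigcup => n; apply/negligibleP => //.
  by apply: measure_itv_eq0 => x /andP[_ xa]; apply: q; exact: le_lt_trans ab.
move=> s /=; rewrite in_itv/= => sa.
exists (Num.bound (a - s)) => //=; rewrite in_itv/= (ltW sa) andbT.
have := archi_boundP (ltW (_ : 0 < a - s)); rewrite subr_gt0 => /(_ sa); lra.
Qed.

(** This reduces both directions of the theorem to kernel bounds as [y -> 0], one real point at a
    time. *)
Lemma msupp_bounded_belowP m : bounded_below (msupp m) <->
  exists b : R, forall x, x < b -> quadratic_at m x.
Proof.
split=> -[b hb]; exists b => x xb.
  by apply: notin_msupp => /hb; rewrite leNgt xb.
rewrite leNgt; apply/negP => xltb.
have e0 : 0 < (b - x) / 2 by lra.
have /gt_eqF/negP := xb _ e0; apply; apply/eqP.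
have := @measure_itv_eq0 m (x - (b - x) / 2) (x + (b - x) / 2).
move=> I; apply: (subset_measure0 _ _ _ (I _)) => //.
- exact: measurable_ball.
- by rewrite ball_itv; move=> z /=; rewrite !in_itv/= => /andP[-> /ltW ->].
- by move=> z /andP[_ zb]; apply: hb; lra.
Qed.

End NullSets.

(** * Cauchy transforms and the generator in terms of kernel integrals *)

Section Transforms.
Variable R : realType.
Implicit Types (x y s : R) (m : {finite_measure set R -> \bar R}) (nu : probability R R).

Lemma cauchyG_kint nu x y : 0 < y ->
  cauchyG nu (Complex x y) = Complex (kintQ nu x y) (- (y * kintP nu x y)).
Proof.
move=> y0; rewrite /cauchyG /cint; congr Complex.
  by apply: eq_Rintegral => s _; rewrite /= /kerQ /kerP subr0.
rewrite -mulNr -RintegralZl//; last exact: bmeas_integrable (bmeas_kerP x y0).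
by apply: eq_Rintegral => s _; rewrite /= /kerP subr0 mulNr.
Qed.

(* |G_nu(x + iy)|² *)
Definition normG nu x y := kintQ nu x y ^+ 2 + y ^+ 2 * kintP nu x y ^+ 2.

Lemma cauchyH_kint nu x y : 0 < y ->
  cauchyH nu (Complex x y) =
  Complex (kintQ nu x y / normG nu x y) (y * kintP nu x y / normG nu x y).
Proof.
by move=> y0; rewrite /cauchyH cauchyG_kint//=; congr Complex;
  rewrite ?sqrrN ?exprMn// mulNr opprK.
Qed.

(* ∫ (1 + s²) / |s - z|² dm(s) *)
Definition weightedP m x y := \int[m]_s kerlc 1 (1 + x ^+ 2 - y ^+ 2) (- 2 * x) x y s.

Lemma kerlc_weightedP x y s : 0 < y ->
  kerlc 1 (1 + x ^+ 2 - y ^+ 2) (- 2 * x) x y s = (1 + s ^+ 2) * kerP x y s.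
Proof.
move=> y0; rewrite /kerlc -{1}(kerPK x s y0) /kerQ; ring.
Qed.

Lemma Im_gen_A gamma m x y : 0 < y ->
  complex.Im (gen_A gamma m (Complex x y)) = y * weightedP m x y.
Proof.
move=> y0; rewrite /gen_A /cint /= oppr0 add0r /weightedP.
rewrite -RintegralZl//; last exact: bmeas_integrable (bmeas_kerlc _ _ _ x y0).
apply: eq_Rintegral => s _; rewrite kerlc_weightedP// /kerP /=.
have d0 := ker_denom_gt0 x s y0.
by field; rewrite gt_eqF//= gt_eqF//; move: d0; lra.
Qed.

Lemma Re_gen_A gamma m x y : 0 < y ->
  complex.Re (gen_A gamma m (Complex x y)) = 
  - gamma + \int[m]_s kerlc x (- (2 * x * y ^+ 2)) (- (1 + x ^+ 2 - y ^+ 2)) x y s.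
Proof.
move=> y0; rewrite /gen_A /cint /=; congr (_ + _).
apply: eq_Rintegral => s _; rewrite /kerlc /kerQ /kerP /=.
have d0 := ker_denom_gt0 x s y0.
by field; rewrite gt_eqF//= gt_eqF//; move: d0; lra.
Qed.

(* ∫ s² / |s - z|² dm(s) *)
Definition kintS m x y := \int[m]_s kerlc 1 (x ^+ 2 - y ^+ 2) (- 2 * x) x y s.

Lemma kerlc_kintS x y s : 0 < y ->
  kerlc 1 (x ^+ 2 - y ^+ 2) (- 2 * x) x y s = s ^+ 2 * kerP x y s.
Proof.
move=> y0; rewrite /kerlc -{1}(kerPK x s y0) /kerQ; ring.
Qed.

Lemma fine_probT nu : fine (nu setT) = 1.
Proof. by rewrite probability_setT. Qed.

Lemma kintP_gt0 nu x y : 0 < y -> 0 < kintP nu x y.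
Proof.
move=> y0; apply: integral_bmeas_gt0; first exact: bmeas_kerP.
  by rewrite /= probability_setT.
by move=> s; exact: kerP_gt0.
Qed.

Lemma normG_gt0 nu x y : 0 < y -> 0 < normG nu x y.
Proof.
by move=> y0; rewrite ltr_wpDl ?sqr_ge0// mulr_gt0// exprn_gt0// kintP_gt0.
Qed.

(* The difference of the two sides is the variance of 1/(z - s). *)
Lemma normG_le nu x y : 0 < y -> normG nu x y <= kintP nu x y.
Proof.
rewrite /normG => y0; set P := kintP nu x y; set Q := kintQ nu x y.
have : 0 <= \int[nu]_s kerlc (Q ^+ 2 + y ^+ 2 * P ^+ 2) (1 - 2 * y ^+ 2 * P) (- 2 * Q) x y s.
  apply: Rintegral_ge0 => s _.
  have k1 := kerPK x s y0.
  rewrite (_ : kerlc _ _ _ _ _ _ = (kerQ x y s - Q) ^+ 2 + (y * kerP x y s - y * P) ^+ 2).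
    by rewrite addr_ge0// sqr_ge0.
  rewrite /kerlc /kerQ; set k := kerP x y s in k1 *.
  have : k * (k * ((x - s) ^+ 2 + y ^+ 2)) = k by rewrite k1 mulr1.
  by move=> kk; rewrite mulrBl mul1r -{1}kk; ring.
rewrite (integral_kerlc nu)// fine_probT -/P -/Q; nra.
Qed.

(** Put [w = 1/(z - s)], so that [E w = G = 1/H]. The first two claims are [normG_le] and
    [|H|^2 = 1/normG]. For the third, [s w = z w - 1] gives
    [E|s w|^2 = |z|^2 E|w|^2 - 2 Re(z G) + 1]; multiplying by [|H|^2] turns this into
    [|H - z|^2 + |z|^2 (Y/y - 1)]. *)
Lemma cauchyH_identities nu x y (X := complex.Re (cauchyH nu (Complex x y)))
    (Y := complex.Im (cauchyH nu (Complex x y))) : 0 < y ->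
  [/\ y <= Y, y * (X ^+ 2 + Y ^+ 2) * kintP nu x y = Y &
   y * (X ^+ 2 + Y ^+ 2) * kintS nu x y =
   y * ((X - x) ^+ 2 + (Y - y) ^+ 2) + (x ^+ 2 + y ^+ 2) * (Y - y)].
Proof.
move=> y0; rewrite {}/X {}/Y cauchyH_kint//= /kintS integral_kerlc// fine_probT.
have P0 := kintP_gt0 nu x y0; have N0 := normG_gt0 nu x y0.
have NP := normG_le nu x y0; rewrite /normG in N0 NP *.
set P := kintP nu x y in P0 N0 NP *; set Q := kintQ nu x y in P0 N0 NP *.
have nz : Q ^+ 2 + y ^+ 2 * P ^+ 2 != 0 by rewrite gt_eqF.
split; [|by field; rewrite exprMn|by field; rewrite exprMn].
by rewrite ler_pdivlMr// ler_wpM2l// ltW.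
Qed.

Lemma cauchyH_Im_ge nu x y : 0 < y -> y <= complex.Im (cauchyH nu (Complex x y)).
Proof. by move=> /(cauchyH_identities nu x)[]. Qed.

End Transforms.

(** * Behaviour of [mu h] as [h] decreases to 0 *)

Section Generator.
Variables (R : realType) (mu : R -> probability R R) (gamma : R).
Variable tau : {finite_measure set R -> \bar R}.
Hypothesis ap : associated_pair mu gamma tau.

Lemma deriv_on_nonneg0 (g dg : R -> R) : deriv_on_nonneg g dg ->
  (fun h => h^-1 * (g h - g 0)) @ 0^'+ --> dg 0.
Proof.
move=> /(_ 0 (lexx 0)).
rewrite (_ : (fun h => _ * _) = (fun h => h^-1 * (g h - g 0))); last first.
  by apply/funext => h; rewrite add0r.
move=> d; apply: cvg_trans d.
apply: cvg_app => A [e /= e0 hA]; exists e => //= h he h0.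
by apply: hA => //=; rewrite ?gt_eqF// add0r ltW.
Qed.

Lemma deriv_on_nonneg_cvg0 (g dg : R -> R) : deriv_on_nonneg g dg ->
  g @ 0^'+ --> g 0.
Proof.
move=> /deriv_on_nonneg0 d.
have : (fun h => h * (h^-1 * (g h - g 0)) + g 0) @ 0^'+ --> 0 * dg 0 + g 0.
  apply: cvgD; last exact: cvg_cst.
  by apply: cvgM d; exact: cvg_within.
rewrite mul0r add0r; apply: cvg_trans; apply: near_eq_cvg.
near=> h; have h0 : h != 0 by rewrite gt_eqF//; near: h; exact: nbhs_right_gt.
by rewrite mulrA mulfV// mul1r subrK.
Unshelve. all: by end_near.
Qed.

Lemma kintS_cvg (x y : R) : 0 < y ->
  (fun h => h^-1 * kintS (mu h) x y) @ 0^'+ --> weightedP tau x y.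
Proof.
move=> y0; pose z := Complex x y.
pose X h := complex.Re (cauchyH (mu h) z); pose Y h := complex.Im (cauchyH (mu h) z).
have zim : complex.Im z != 0 by rewrite gt_eqF.
have [H0 [dX dY]] := ap zim.
have X0 : X 0 = x by rewrite /X H0.
have Y0 : Y 0 = y by rewrite /Y H0.
have cX : X @ 0^'+ --> x by rewrite -X0; exact: deriv_on_nonneg_cvg0 dX.
have cY : Y @ 0^'+ --> y by rewrite -Y0; exact: deriv_on_nonneg_cvg0 dY.
set T := weightedP _ _ _; pose a := complex.Re (gen_A gamma tau z).
have {}dX : (fun h => h^-1 * (X h - x)) @ 0^'+ --> a.
  by move: (deriv_on_nonneg0 dX); rewrite H0.
have {}dY : (fun h => h^-1 * (Y h - y)) @ 0^'+ --> y * T.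
  by move: (deriv_on_nonneg0 dY); rewrite H0 Im_gen_A.
set uX := (fun h => h^-1 * (X h - x)) in dX.
set uY := (fun h => h^-1 * (Y h - y)) in dY.
have sq (f : R -> R) (l : R) : f @ 0^'+ --> l -> (fun h => f h ^+ 2) @ 0^'+ --> l ^+ 2.
  by move=> fl; rewrite expr2; under eq_fun do rewrite expr2; exact: cvgM.
have N0 : 0 < x ^+ 2 + y ^+ 2 by rewrite ltr_wpDl ?sqr_ge0// exprn_gt0.
(* This is the third identity of [cauchyH_identities] divided by [h]: the term [|H - z|^2 / h]
   equals [h] times squared difference quotients and vanishes in the limit, so only the derivative
   of the imaginary part survives. *)
have : (fun h => (y * (h * (uX h ^+ 2 + uY h ^+ 2)) + (x ^+ 2 + y ^+ 2) * uY h) /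
                 (y * (X h ^+ 2 + Y h ^+ 2))) @ 0^'+ -->
   (y * (0 * (a ^+ 2 + (y * T) ^+ 2)) + (x ^+ 2 + y ^+ 2) * (y * T)) /
                 (y * (x ^+ 2 + y ^+ 2)).
  apply: cvgM.
    apply: cvgD; last by apply: cvgM dY; exact: cvg_cst.
    apply: cvgM; first exact: cvg_cst.
    apply: cvgM; first exact: cvg_within.
    by apply: cvgD; exact: sq.
  apply: cvgV; first by rewrite gt_eqF// mulr_gt0.
  by apply: cvgM; [exact: cvg_cst|apply: cvgD; exact: sq].
have -> : (y * (0 * (a ^+ 2 + (y * T) ^+ 2)) + (x ^+ 2 + y ^+ 2) * (y * T)) /
                 (y * (x ^+ 2 + y ^+ 2)) = T.
  by field; rewrite !gt_eqF.
apply: cvg_trans; apply: near_eq_cvg; near=> h.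
have h0 : h != 0 by rewrite gt_eqF//; near: h; exact: nbhs_right_gt.
have [yY _ S] := cauchyH_identities (mu h) x y0.
rewrite -/z -/(X h) -/(Y h) in yY S.
have M0 : 0 < X h ^+ 2 + Y h ^+ 2.
  by rewrite ltr_wpDl ?sqr_ge0// exprn_gt0//; exact: lt_le_trans yY.
have -> : kintS (mu h) x y = y * (X h ^+ 2 + Y h ^+ 2) * kintS (mu h) x y /
     (y * (X h ^+ 2 + Y h ^+ 2)) by field; rewrite !gt_eqF.
by rewrite S /uX /uY; field; rewrite h0 !gt_eqF.
Unshelve. all: by end_near.
Qed.

(** At [z = i] the integrand is [s^2 / (1 + s^2)], so this expresses that [mu h] concentrates at
    0. *)
Lemma kintS_cvg0 (x y : R) : 0 < y -> (fun h => kintS (mu h) x y) @ 0^'+ --> (0 : R).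
Proof.
move=> y0; have : (fun h => h * (h^-1 * kintS (mu h) x y)) @ 0^'+ --> 0 * weightedP tau x y.
  by apply: cvgM; [exact: cvg_within|exact: kintS_cvg].
rewrite mul0r; apply: cvg_trans; apply: near_eq_cvg; near=> h.
have h0 : h != 0 by rewrite gt_eqF//; near: h; exact: nbhs_right_gt.
by rewrite mulrA mulfV// mul1r.
Unshelve. all: by end_near.
Qed.


End Generator.

(** * Kernel estimates for a single probability measure *)

Section Estimates.
Variable R : realType.
Implicit Types (x y s r a C : R) (nu : probability R R).
Implicit Types (m : {finite_measure set R -> \bar R}).

Lemma le_integral_kerlc m a b c x a' b' c' x' y y' (D : set R) : 0 < y -> 0 < y' ->
  measurable D -> m (~` D) = 0%E ->
  (forall s, D s -> kerlc a b c x y s <= kerlc a' b' c' x' y' s) ->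
  \int[m]_s kerlc a b c x y s <= \int[m]_s kerlc a' b' c' x' y' s.
Proof.
by move=> y0 y0' mD D0 h; apply: le_integral_bmeas mD D0 _ _ h; exact: bmeas_kerlc.
Qed.

(** Every [x'] in the ball lies at distance at least [r] to the left of the mass, so the kernel is
    at most [r^-2], while [- kintQ] integrates a positive function and stays away from 0. The
    constant is uniform in [x'] and [y], so that later a single small time serves a whole
    interval. *)
Lemma kintP_le_normG nu a x r : 0 < r -> x + 2 * r <= a ->
  nu (~` `[a, +oo[%classic) = 0%E ->
  exists2 C, 0 < C & forall x' y, ball x r x' -> 0 < y -> y < 1 ->
    kintP nu x' y <= C * normG nu x' y.
Proof.
(* The point [x - r + i] is farther from the mass than any [x' + iy] considered, so its kernel,
   times the least distance [r], bounds [(s - x') / |x' + iy - s|^2] from below. *)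
move=> r0 xa na; pose c := r * kintP nu (x - r) 1.
have c0 : 0 < c by rewrite mulr_gt0// kintP_gt0.
exists (r ^- 2 / c ^+ 2); first by rewrite divr_gt0 ?invr_gt0 ?exprn_gt0.
move=> x' y /ltr_normlP[xl xr] y0 y1.
have mD : measurable `[a, +oo[%classic by [].
have P1 : kintP nu x' y <= r ^- 2.
  have -> : kintP nu x' y = \int[nu]_s kerlc 0 1 0 x' y s.
    by rewrite integral_kerlc//; ring.
  have -> : r ^- 2 = \int[nu]_s kerlc (r ^- 2) 0 0 x' y s.
    by rewrite integral_kerlc// fine_probT; ring.
  apply: (le_integral_kerlc y0 y0 mD na) => s /=; rewrite in_itv/= andbT => sa.
  rewrite /kerlc !mul0r add0r mul1r !addr0 /kerP.
  rewrite lef_pV2 ?posrE ?ker_denom_gt0 ?exprn_gt0//.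
  nra.
have Q1 : c <= - kintQ nu x' y.
  have -> : - kintQ nu x' y = \int[nu]_s kerlc 0 0 (- 1) x' y s.
    by rewrite integral_kerlc//; ring.
  have -> : c = \int[nu]_s kerlc 0 r 0 (x - r) 1 s.
    by rewrite integral_kerlc// /c; ring.
  apply: (le_integral_kerlc ltr01 y0 mD na) => s /=; rewrite in_itv/= andbT => sa.
  rewrite /kerlc /kerQ /kerP !mul0r !add0r addr0 mulN1r -mulNr.
  rewrite ler_pdivrMr ?ker_denom_gt0// mulrAC ler_pdivlMr ?ker_denom_gt0//.
  have u1 : r <= s - x' by lra.
  have u2 : s - x' <= s - x + r by lra.
  set u := s - x' in u1 u2 *; set v := s - x + r in u2 *.
  rewrite (_ : x' - s = - u); last by rewrite /u; ring.
  rewrite (_ : x - r - s = - v); last by rewrite /v; ring.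
  rewrite sqrrN sqrrN opprK expr1n.
  have h1 : r * u ^+ 2 <= u * v ^+ 2.
    apply: (@le_trans _ _ (u * u ^+ 2)); first by rewrite ler_wpM2r ?sqr_ge0.
    have u0 : 0 <= u by lra.
    have v0 : 0 <= v by lra.
    by rewrite ler_wpM2l// ler_pXn2r.
  have h2 : r * y ^+ 2 <= u * 1.
    apply: (@le_trans _ _ (r * 1)); last by rewrite !mulr1.
    by rewrite ler_wpM2l ?(ltW r0)// expr_le1// ltW.
  by lra.
have P0 := kintP_gt0 nu x' y0.
apply: (le_trans P1); rewrite mulrAC ler_pdivlMr ?exprn_gt0// ler_wpM2l ?invr_ge0 ?sqr_ge0//.
apply: (@le_trans _ _ (kintQ nu x' y ^+ 2)); last by rewrite lerDl -exprMn sqr_ge0.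
by rewrite -[leRHS]sqrrN ler_pXn2r ?nnegrE//; [exact: ltW|exact: le_trans (ltW c0) Q1].
Qed.

(* Split the pairing of w(s) = 1/(z - s) with c = E[w] at |s| = r: near 0 the kernel is
   bounded, and far from 0 Young's inequality pays with the small mass of the tail. *)
Lemma kintP_bound nu C x x' y : 0 < C -> x < 0 -> ball x (- x / 4) x' -> 0 < y ->
  kintS nu 0 1 <= (- x / 4) ^+ 2 / ((- x / 4) ^+ 2 + 1) / (4 * C) ->
  kintP nu x' y <= C * normG nu x' y -> kintP nu x' y <= 16 * C / x ^+ 2.
Proof.
move=> C0 x0; set r := - x / 4 => xx' y0 Sr PN.
have r0 : 0 < r by rewrite /r; lra.
have r20 : 0 < r ^+ 2 by rewrite exprn_gt0.
pose f0 := r ^+ 2 / (r ^+ 2 + 1).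
have f00 : 0 < f0 by rewrite divr_gt0// ltr_wpDl// ltW.
set N := normG nu x' y in PN *; set P := kintP nu x' y in PN *; pose Q := kintQ nu x' y.
have NE : N = Q ^+ 2 + y ^+ 2 * P ^+ 2 by [].
have N0 : 0 < N by exact: normG_gt0.
have x20 : 0 < x ^+ 2 by rewrite expr2 nmulr_rgt0.
pose k2 := 4 / x ^+ 2.
pose B := C * N / f0.
have B0 : 0 < B by rewrite divr_gt0// mulr_gt0.
have : \int[nu]_s kerlc 0 (y ^+ 2 * P) Q x' y s <=
    \int[nu]_s (1 * kerlc (N / 4 + k2) (4 * C)^-1 0 x' y s +
      B * kerlc 1 (0 ^+ 2 - 1 ^+ 2) (- 2 * 0) 0 1 s).
  apply: (@le_integral_bmeas R nu setT) => //.
  - by rewrite setCT measure0.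
  - exact: bmeas_kerlc.
  - by apply: bmeasD; apply: bmeasZ; exact: bmeas_kerlc.
  move=> s _; rewrite mul1r kerlc_kintS// /kerlc.
  set p := kerP x' y s; set q := kerQ x' y s.
  have p0 : 0 < p by exact: kerP_gt0.
  have pE : q ^+ 2 + y ^+ 2 * p ^+ 2 = p.
    have pD : p * (p * ((x' - s) ^+ 2 + y ^+ 2)) = p by rewrite kerPK// mulr1.
    by apply: (etrans _ pD); rewrite /q /kerQ -/p; ring.
  have young l : 0 < l -> y ^+ 2 * P * p + Q * q <= l * N + (4 * l)^-1 * p.
    move=> l0; rewrite -subr_ge0 NE.
    have -> : (4 * l)^-1 * p = (4 * l)^-1 * (q ^+ 2 + y ^+ 2 * p ^+ 2) by rewrite pE.
    have -> : l * (Q ^+ 2 + y ^+ 2 * P ^+ 2) + (4 * l)^-1 * (q ^+ 2 + y ^+ 2 * p ^+ 2) -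
        (y ^+ 2 * P * p + Q * q) =
       ((2 * l * Q - q) ^+ 2 + (y * (2 * l * P - p)) ^+ 2) / (4 * l).
      by field; rewrite gt_eqF.
    by apply: divr_ge0; [rewrite addr_ge0// sqr_ge0|lra].
  have k0 := kerP_gt0 0 s (@ltr01 R).
  have t0 : 0 <= B * (s ^+ 2 * kerP 0 1 s).
    by apply: mulr_ge0; [exact: ltW|apply: mulr_ge0; [exact: sqr_ge0|exact: ltW]].
  have cp : 0 <= (4 * C)^-1 * p by apply: mulr_ge0; [rewrite invr_ge0; lra|exact: ltW].
  have [sr|rs] := ltP `|s| r.
    have y4 := young 4^-1 _; rewrite mulfV// invr1 mul1r in y4.
    have {}y4 := y4 ltac:(lra).
    have pk : p <= k2.
      rewrite /k2 /p /kerP -[4 / _]invf_div lef_pV2 ?posrE ?ker_denom_gt0 ?divr_gt0//.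
      move/ltr_normlP : sr => [s1 s2]; move/ltr_normlP : xx' => [x1 x2].
      have : (- x / 2) ^+ 2 <= (s - x') ^+ 2.
        by rewrite ler_pXn2r// ?nnegrE; rewrite /r in r0 s1 s2 x1 x2; lra.
      have : 0 <= y ^+ 2 by exact: sqr_ge0.
      nra.
    rewrite mul0r add0r addr0; lra.
  have yC := young C C0.
  have ff : f0 <= s ^+ 2 * kerP 0 1 s.
    rewrite /kerP sub0r sqrrN expr1n /f0.
    have s2 : r ^+ 2 <= s ^+ 2.
      by rewrite -[leRHS]real_normK ?num_real// ler_pXn2r ?nnegrE// ltW.
    rewrite ler_pdivrMr; last by lra.
    by rewrite mulrAC ler_pdivlMr; nra.
  have BB : C * N <= B * (s ^+ 2 * kerP 0 1 s).
    apply: (@le_trans _ _ (B * f0)); last by rewrite (ler_wpM2l (ltW B0)).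
    by rewrite /B divfK// gt_eqF.
  have k20 : 0 < k2 by rewrite divr_gt0.
  rewrite mul0r add0r addr0; lra.
(* The left side integrates to [N] and the right side to [N/4 + k2 + P/(4C) + B * kintS nu 0 1].
   Each of the last two terms is at most [N/4], hence [N <= 4 * k2] and
   [P <= C * N <= 16 * C / x^2]. *)
rewrite integral_bmeas_lc; [|exact: bmeas_kerlc|exact: bmeas_kerlc].
rewrite -/(kintS nu 0 1) !integral_kerlc// fine_probT -/P -/Q.
have BS : B * kintS nu 0 1 <= N / 4.
  have -> : N / 4 = B * (f0 / (4 * C)).
    by rewrite /B; field; rewrite !gt_eqF.
  by rewrite (ler_wpM2l (ltW B0)).
have PC : (4 * C)^-1 * P <= N / 4.
  by rewrite ler_pdivrMl; lra.
have e1 : 16 * C / x ^+ 2 = C * (4 * k2) by rewrite /k2; field; rewrite lt_eqF.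
move=> ineq; rewrite e1; apply: (le_trans PN); rewrite (ler_wpM2l (ltW C0))//.
move: NE; lra.
Qed.

(** For [u = |x - s| >= e], [1/(u^2 + y^2) <= 1/u^2] and [(u^2 + 1)/u^2 <= 1 + e^-2]; the resulting
    bound does not depend on [y]. *)
Lemma kintS_le nu x e y (D : set R) : 0 < e -> 0 < y -> y < 1 ->
  measurable D -> nu (~` D) = 0%E -> (forall s, D s -> e <= `|x - s|) ->
  kintS nu x y <= (1 + e ^- 2) * kintS nu x 1.
Proof.
move=> e0 y0 y1 mD D0 De.
rewrite /kintS -RintegralZl//; last exact: (bmeas_integrable nu (bmeas_kerlc _ _ _ x ltr01)).
apply: (le_integral_bmeas mD D0).
- exact: bmeas_kerlc.
- by apply: bmeasZ; exact: bmeas_kerlc.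
move=> s /De es; rewrite !kerlc_kintS// mulrCA ler_wpM2l ?sqr_ge0// /kerP.
rewrite ler_pdivlMr ?ker_denom_gt0// mulrC ler_pdivrMr ?ker_denom_gt0// expr1n.
have : e ^+ 2 <= (x - s) ^+ 2.
  by rewrite -[leRHS]real_normK ?num_real// ler_pXn2r ?nnegrE// ltW.
have e20 : 0 < e ^+ 2 by rewrite exprn_gt0.
set u2 := (x - s) ^+ 2 => h.
have h1 : 1 <= e ^- 2 * u2 by rewrite ler_pdivlMl// mulr1.
have h2 : 0 <= (1 + e ^- 2) * y ^+ 2 by rewrite mulr_ge0 ?sqr_ge0// addr_ge0// invr_ge0 ltW.
rewrite mulrDr mulrDl mul1r; lra.
Qed.

End Estimates.

(** * From the support of one [mu t0] to the support of [tau] *)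

Section SupportOfTau.
Variables (R : realType) (mu : R -> probability R R) (gamma : R).
Variable tau : {finite_measure set R -> \bar R}.
Hypotheses (sg : monotone_semigroup mu) (ap : associated_pair mu gamma tau).

(** [H_t] is [H_s] followed by [H_(t-s)], and no such map lowers the imaginary part. *)
Lemma Im_cauchyH_nondecreasing (s t x y : R) : 0 < y -> 0 <= s -> s <= t ->
  complex.Im (cauchyH (mu s) (Complex x y)) <= complex.Im (cauchyH (mu t) (Complex x y)).
Proof.
move=> y0 s0 st; have := sg (_ : 0 <= t - s) s0 (_ : 0 < complex.Im (Complex x y)).
rewrite subrK => -> //; last by rewrite subr_ge0.
have := cauchyH_Im_ge (mu s) x y0; case: (cauchyH (mu s) _) => X Y /= yY.
exact/cauchyH_Im_ge/(lt_le_trans y0).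
Qed.

Lemma kintP_le_normG_backward (C s t x y : R) : 0 < y -> 0 <= s -> s <= t ->
  kintP (mu t) x y <= C * normG (mu t) x y -> kintP (mu s) x y <= C * normG (mu s) x y.
Proof.
move=> y0 s0 st; have := Im_cauchyH_nondecreasing x y0 s0 st.
rewrite !cauchyH_kint//= => h.
have Ns : 0 < normG (mu s) x y by exact: normG_gt0.
have Nt : 0 < normG (mu t) x y by exact: normG_gt0.
rewrite -!ler_pdivrMr//; apply: le_trans.
by move: h; rewrite -!mulrA ler_pM2l.
Qed.

Lemma mu_null_near (t0 a x : R) : 0 < t0 -> mu t0 (~` `[a, +oo[%classic) = 0%E ->
  x < 0 -> x <= 2 * a ->
  \forall h \near 0^'+, mu h `]x - - x / 8, x + - x / 8]%classic = 0%E.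
Proof.
(* This is the radius used in [kintP_bound]; then [x + 2 * r = x / 2], which is where [x <= 2 * a]
   comes from. *)
move=> t00 na x0 xa; pose r := - x / 4.
have r0 : 0 < r by rewrite /r; lra.
have xr : x + 2 * r <= a by rewrite /r; lra.
have [C C0 hC] := kintP_le_normG r0 xr na.
near=> h.
have h0 : 0 < h by near: h; exact: nbhs_right_gt.
have ht : h <= t0 by near: h; exact: nbhs_right_le.
(* The threshold depends only on [r] and [C], so [h] is fixed before [x'] and [y] are introduced. *)
have Sh : kintS (mu h) 0 1 <= r ^+ 2 / (r ^+ 2 + 1) / (4 * C).
  near: h; apply: (cvgr_le _ (kintS_cvg0 ap 0 ltr01)).
  have r20 : 0 < r ^+ 2 by exact: exprn_gt0.
  by apply: divr_gt0; [apply: divr_gt0; lra|lra].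
apply: measure_itv_eq0 => x' /andP[x1 x2]; apply: quadratic_kintP.
have xx' : ball x r x' by apply/ltr_normlP; rewrite /r; split; lra.
exists (16 * C / x ^+ 2) => y y0 y1.
apply: (kintP_bound C0 x0 xx' y0 Sh).
by apply: (kintP_le_normG_backward y0 (ltW h0) ht); exact: hC.
Unshelve. all: by end_near.
Qed.

Lemma tau_quadratic (t0 a x : R) : 0 < t0 -> mu t0 (~` `[a, +oo[%classic) = 0%E ->
  x < 0 -> x <= 2 * a -> quadratic_at tau x.
Proof.
move=> t00 na x0 xa; apply: quadratic_kintP; pose r := - x / 8.
have r0 : 0 < r by rewrite /r; lra.
exists ((1 + r ^- 2) * weightedP tau x 1) => y y0 y1.
(* The weight [1 + s^2] is at least 1, and the weighted integral is the one obtained as a limit of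
   [kintS (mu h) x y / h]. *)
apply: (@le_trans _ _ (weightedP tau x y)).
  apply: (@le_integral_bmeas R tau setT) => //.
  - by rewrite setCT measure0.
  - exact: bmeas_kerP.
  - exact: bmeas_kerlc.
  move=> s _; rewrite kerlc_weightedP// mulrDl mul1r lerDl mulr_ge0 ?sqr_ge0//.
  exact/ltW/kerP_gt0.
have cv1 := @kintS_cvg _ _ _ _ ap x y y0.
have cv2 : (fun h => (1 + r ^- 2) * (h^-1 * kintS (mu h) x 1)) @ 0^'+ -->
    (1 + r ^- 2) * weightedP tau x 1.
  by apply: cvgM (@kintS_cvg _ _ _ _ ap x 1 ltr01); exact: cvg_cst.
apply: (ler_cvg_to cv1 cv2); near=> h.
have h0 : 0 < h by near: h; exact: nbhs_right_gt.
rewrite mulrCA ler_pM2l ?invr_gt0//.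
pose D := ~` `]x - r, x + r]%classic.
apply: (@kintS_le R (mu h) x r y D) => //.
- exact: measurableC.
- by rewrite setCK; near: h; exact: mu_null_near t00 na x0 xa.
move=> s /= /negP; rewrite in_itv/= negb_and -leNgt -ltNge => /orP[]sx.
  by rewrite ger0_norm; lra.
by rewrite distrC ger0_norm; lra.
Unshelve. all: by end_near.
Qed.

Lemma tau_bounded_below (t0 : R) : 0 < t0 -> bounded_below (msupp (mu t0)) ->
  bounded_below (msupp tau).
Proof.
move=> t00 /msupp_bounded_belowP[b qb]; apply/msupp_bounded_belowP.
(* The ray must start strictly below [b], hence at [b - 1]; the minimum encodes the conditions
   [x < 0] and [x <= 2 * a] for [a = b - 1]. *)
exists (Num.min 0 (2 * (b - 1))) => x; rewrite lt_min => /andP[x0 xb].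
apply: (@tau_quadratic t0 (b - 1)) (ltW xb) => //.
by apply: (measure_ray_eq0 qb); lra.
Qed.

End SupportOfTau.

(** * One-sided derivatives and a Gronwall inequality *)

Section DifferentialInequality.
Variable R : realType.
Implicit Types (g dg : R -> R) (t T K : R).

Lemma deriv_on_nonneg_is_derive g dg t : deriv_on_nonneg g dg -> 0 < t ->
  is_derive t 1 g (dg t).
Proof.
move=> d t0.
have cv : (fun h => h^-1 *: (g (h *: (1 : R) + t) - g t)) @ 0^' --> dg t.
  rewrite (_ : (fun h => _) = (fun h => h^-1 * (g (t + h) - g t))); last first.
    by apply/funext => h; rewrite /GRing.scale/= mulr1 [t + h]addrC.
  apply: cvg_trans (d t (ltW t0)); apply: cvg_app => A wA.
  have th : \forall h \near (0 : R)^', 0 <= t + h.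
    near=> h; have : `|h| < t by near: h; exact: dnbhs0_lt.
    by move=> /ltr_normlP[]; lra.
  rewrite /nbhs/= in wA th *; rewrite /within/= in wA.
  near=> h; have : 0 <= t + h by near: h.
  by near: h; exact: wA.
apply: DeriveDef; last exact/cvg_lim.
by apply/cvg_ex; exists (dg t).
Unshelve. all: by end_near.
Qed.

Lemma deriv_on_nonneg_continuous g dg t : deriv_on_nonneg g dg -> 0 < t ->
  {for t, continuous g}.
Proof.
move=> d t0; apply: differentiable_continuous; apply/derivable1_diffP.
by have [] := deriv_on_nonneg_is_derive d t0.
Qed.

Lemma deriv_on_nonneg_cvg_right g dg t : deriv_on_nonneg g dg -> 0 <= t ->
  g @ t^'+ --> g t.
Proof.
move=> d; rewrite le_eqVlt => /predU1P[<-|t0]; first exact: deriv_on_nonneg_cvg0 d.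
by apply: cvg_at_right_filter; exact: deriv_on_nonneg_continuous d t0.
Qed.

(** The function [g t * expR (- K * t)] has derivative at most 0 inside []0, T[], so the mean value
    theorem applies; at 0 it only asks for continuity from the right. The rate [K] is used with
    either sign below. *)
Lemma deriv_on_nonneg_gronwall g dg K T : deriv_on_nonneg g dg -> 0 <= T ->
  (forall t, 0 < t -> t < T -> dg t <= K * g t) -> g T <= g 0 * expR (K * T).
Proof.
move=> d T0 dgK.
pose e t := expR (- K * t); pose f t := g t * e t.
have de t : is_derive t 1 e (- K * e t).
  have : is_derive t 1 (expR \o (fun s => - K * s)) (- K * expR (- K * t)).
    apply: is_derive_eq; rewrite /GRing.scale/=; ring.
  by [].
have df t : t \in `]0, T[%R -> is_derive t 1 f (g t * (- K * e t) + e t * dg t).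
  rewrite in_itv/= => /andP[t0 _].
  have dgt := deriv_on_nonneg_is_derive d t0; have det := de t.
  exact: is_deriveM.
have ce t : {for t, continuous e}.
  by apply: differentiable_continuous; apply/derivable1_diffP; have [] := de t.
move: T0; rewrite le_eqVlt => /predU1P[<-|T0]; first by rewrite mulr0 expR0 mulr1.
have cf : {within `[0, T], continuous f}.
  apply/continuous_within_itvP => //; split.
  - move=> t; rewrite in_itv/= => /andP[t0 _].
    by apply: cvgM; [exact: deriv_on_nonneg_continuous d t0|exact: ce].
  - apply: cvgM; first exact: deriv_on_nonneg_cvg_right d _.
    by apply: cvg_at_right_filter; exact: ce.
  - apply: cvgM; apply: cvg_at_left_filter; last exact: ce.
    exact: deriv_on_nonneg_continuous d T0.
have [c] := MVT T0 df cf.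
rewrite in_itv/= => /andP[c0 cT] fE.
have : f T <= f 0.
  rewrite -subr_le0 fE subr0; apply: mulr_le0_ge0; last exact: ltW.
  have -> : g c * (- K * e c) + e c * dg c = e c * (dg c - K * g c) by ring.
  by rewrite pmulr_rle0 ?expR_gt0// subr_le0 dgK.
rewrite /f /e mulr0 expR0 mulr1 mulNr expRN.
by rewrite ler_pdivrMr// expR_gt0.
Qed.


End DifferentialInequality.

(** * Flow of the generator when [tau] lives on [[b, +oo[] *)

Section Flow.
Variables (R : realType) (mu : R -> probability R R) (gamma : R).
Variable tau : {finite_measure set R -> \bar R}.
Hypothesis ap : associated_pair mu gamma tau.
Variable b : R.
Hypotheses (b0 : b <= 0) (tb : tau (~` `[b, +oo[%classic) = 0%E).

Let M := fine (tau setT).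

Let M_ge0 : 0 <= M. Proof. exact: fine_ge0. Qed.

(** With [w = s - b + 1 >= 1], one has [|s| <= (2 - b) * w] and [|s - z| >= s - X >= w], so the
    integrand is at most [1 + (2 - b)^2]. *)
Lemma weightedP_le (X Y : R) : X <= b - 1 -> 0 < Y ->
  weightedP tau X Y <= (1 + (2 - b) ^+ 2) * M.
Proof.
move=> Xb Y0; have -> : (1 + (2 - b) ^+ 2) * M =
    \int[tau]_s kerlc (1 + (2 - b) ^+ 2) 0 0 X Y s.
  by rewrite integral_kerlc// !mul0r !addr0.
apply: (le_integral_kerlc Y0 Y0 _ tb) => // s /=; rewrite in_itv/= andbT => bs.
rewrite kerlc_weightedP// /kerlc !mul0r !addr0 ler_pdivrMr ?ker_denom_gt0//.
have w1 : 1 <= s - b + 1 by lra.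
have h1 : 1 + s ^+ 2 <= (1 + (2 - b) ^+ 2) * (s - b + 1) ^+ 2.
  set w := s - b + 1 in w1 *; have -> : s = w + (b - 1) by rewrite /w; ring.
  have w2 : 1 <= w ^+ 2 by exact: exprn_ege1.
  have : (w + (b - 1)) ^+ 2 <= ((2 - b) * w) ^+ 2.
    have bw : 0 <= - b * (w - 1) by apply: mulr_ge0; move: b0; lra.
    by rewrite -subr_ge0 subr_sqr; apply: mulr_ge0; move: b0 w1 bw; lra.
  rewrite exprMn; lra.
apply: (le_trans h1); rewrite ler_wpM2l//; first by rewrite addr_ge0// sqr_ge0.
apply: (@le_trans _ _ ((X - s) ^+ 2)); last by rewrite lerDl sqr_ge0.
by rewrite -[leRHS]sqrrN ler_pXn2r// ?nnegrE; lra.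
Qed.

(** The integrand is at most [(3 - 2 * b) * (- X)] for each [s >= b], and [- X >= 1] lets [- gamma]
    be absorbed into a bound linear in [X]. *)
Lemma Re_gen_A_le (X Y : R) : X <= b - 1 -> 0 < Y ->
  complex.Re (gen_A gamma tau (Complex X Y)) <= - (`|gamma| + (3 - 2 * b) * M) * X.
Proof.
move=> Xb Y0; rewrite Re_gen_A//.
have : \int[tau]_s kerlc X (- (2 * X * Y ^+ 2)) (- (1 + X ^+ 2 - Y ^+ 2)) X Y s <=
    \int[tau]_s kerlc (- (3 - 2 * b) * X) 0 0 X Y s.
  apply: (le_integral_kerlc Y0 Y0 _ tb) => // s /=; rewrite in_itv/= andbT => bs.
  rewrite /kerlc !mul0r !addr0 /kerQ -subr_ge0.
  have k0 := kerP_gt0 X s Y0; have kK := kerPK X s Y0.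
  set k := kerP X Y s in k0 kK *.
  set v := s - X; have v1 : 1 <= v by rewrite /v; lra.
  pose W := - X; have W1 : 1 - b <= W by rewrite /W; lra.
  have vW : W + b <= v by rewrite /v /W; lra.
  rewrite (_ : (X - s) ^+ 2 = v ^+ 2) in kK; last by rewrite /v; ring.
  rewrite (_ : X - s = - v); last by rewrite /v; ring.
  rewrite (_ : X = - W); last by rewrite /W; ring.
  have -> : - (3 - 2 * b) * - W -
     (- W + - (2 * - W * Y ^+ 2) * k + - (1 + (- W) ^+ 2 - Y ^+ 2) * (- v * k)) =
     k * ((4 - 2 * b) * W * v ^+ 2 - (1 + W ^+ 2) * v +
          ((2 - 2 * b) * W + v) * Y ^+ 2).
    have WE : W = W * (k * (v ^+ 2 + Y ^+ 2)) by rewrite kK mulr1.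
    transitivity ((4 - 2 * b) * (W * (k * (v ^+ 2 + Y ^+ 2))) - 2 * W * Y ^+ 2 * k -
      (1 + W ^+ 2 - Y ^+ 2) * v * k); last by ring.
    by rewrite -WE; ring.
  have bW : 0 <= - b * W by apply: mulr_ge0; move: b0; lra.
  apply: mulr_ge0; first exact: ltW.
  apply: addr_ge0; last by apply: mulr_ge0; [move: b0; lra|exact: sqr_ge0].
  (* What remains is [1 + W^2 <= (4 - 2 * b) * W * v]. Since [v >= W + b] and
     [(4 - 2 * b) * (W + b) >= 2 * W], the right side is at least [2 * W^2], and [W >= 1]. *)
  have -> : (4 - 2 * b) * W * v ^+ 2 - (1 + W ^+ 2) * v =
            v * ((4 - 2 * b) * W * v - (1 + W ^+ 2)) by ring.
  apply: mulr_ge0; first lra.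
  have W10 : 1 <= W by move: b0; lra.
  have h1 : (4 - 2 * b) * W * (W + b) <= (4 - 2 * b) * W * v by rewrite ler_wpM2l//; lra.
  have b2 : 0 <= - b * (W - (1 - b)) by apply: mulr_ge0; move: b0; lra.
  have h2 : 2 * W <= (4 - 2 * b) * (W + b) by lra.
  have h3 : 2 * W * W <= (4 - 2 * b) * (W + b) * W by rewrite ler_wpM2r//; lra.
  have h4 : 1 <= W ^+ 2 by exact: exprn_ege1.
  lra.
rewrite (integral_kerlc tau (- (3 - 2 * b) * X))// -/M !mul0r !addr0 => h.
have h1 : - gamma <= `|gamma| * - X.
  apply: (le_trans (ler_norm _)); rewrite normrN ler_peMr//; move: b0; lra.
lra.
Qed.

Let K := `|gamma| + (3 - 2 * b) * M.

Let K_ge0 : 0 <= K.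
Proof. by rewrite addr_ge0// mulr_ge0//; move: b0; lra. Qed.

(** * Trajectories starting far to the left *)

Section Trajectory.
Variables x y T : R.
Hypotheses (y0 : 0 < y) (T0 : 0 <= T) (xT : x < (b - 1) * expR (K * T)).
Let z := Complex x y.
Let X (t : R) := complex.Re (cauchyH (mu t) z).
Let Y (t : R) := complex.Im (cauchyH (mu t) z).

Let XYE t : cauchyH (mu t) z = Complex (X t) (Y t).
Proof. by rewrite /X /Y; case: (cauchyH _ _). Qed.

Let dX : deriv_on_nonneg X (fun t => complex.Re (gen_A gamma tau (cauchyH (mu t) z))).
Proof. by have [|_ []] := ap (_ : complex.Im z != 0); rewrite ?gt_eqF. Qed.

Let dY : deriv_on_nonneg Y (fun t => complex.Im (gen_A gamma tau (cauchyH (mu t) z))).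
Proof. by have [|_ []] := ap (_ : complex.Im z != 0); rewrite ?gt_eqF. Qed.

Let X0 : X 0 = x.
Proof. by have [|H0 _] := ap (_ : complex.Im z != 0); rewrite ?gt_eqF// /X H0. Qed.

Let Y0 : Y 0 = y.
Proof. by have [|H0 _] := ap (_ : complex.Im z != 0); rewrite ?gt_eqF// /Y H0. Qed.

Let Y_gt0 t : 0 < Y t.
Proof. exact: lt_le_trans y0 (cauchyH_Im_ge _ _ y0). Qed.

(** Gronwall at rate [- K] gives [X t <= x * expR (- K * t)], and [xT] places this strictly below
    [b - 1]. The gain from a weak to a strict inequality drives the continuation argument that
    follows. *)
Lemma Re_trajectory_step t : 0 <= t -> t <= T -> (forall s, 0 < s -> s < t -> X s <= b - 1) ->
  X t < b - 1.
Proof.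
move=> t0 tT Xb; have := deriv_on_nonneg_gronwall (K := - K) dX t0.
have h s : 0 < s -> s < t -> complex.Re (gen_A gamma tau (cauchyH (mu s) z)) <= - K * X s.
  by move=> s0 st; rewrite XYE; apply: Re_gen_A_le; [exact: Xb|exact: Y_gt0].
move=> /(_ h)/le_lt_trans; apply.
rewrite X0 mulNr expRN ltr_pdivrMr ?expR_gt0//; apply: (lt_le_trans xT).
rewrite ler_wnM2l//; first by move: b0; lra.
by rewrite ler_expR ler_wpM2l.
Qed.

(** Otherwise let [inf E] be the first exit time. The previous step makes the inequality strict
    there, and continuity from the right carries it past [inf E], contradicting the points of [E]
    arbitrarily close to it. *)
Lemma Re_trajectory t : 0 <= t -> t <= T -> X t < b - 1.
Proof.
move=> t0 tT; rewrite ltNge; apply/negP => bX.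
pose E := [set s | 0 <= s <= T /\ b - 1 <= X s].
have hE : has_inf E.
  split; first by exists t; split=> //; rewrite t0.
  by exists 0 => s [/andP[]].
have i0 : 0 <= inf E by apply: lb_le_inf; [case: hE|move=> s [/andP[]]].
have iT : inf E <= T.
  apply: (le_trans _ tT); apply: ge_inf; first by case: hE.
  by split=> //; rewrite t0.
have Xi : X (inf E) < b - 1.
  apply: Re_trajectory_step => // s s0 si; rewrite leNgt; apply/negP => bs.
  suff : inf E <= s by rewrite leNgt si.
  apply: ge_inf; first by case: hE.
  by split; [rewrite (ltW s0)/= (le_trans (ltW si))|exact: ltW].
have : \forall s \near (inf E)^'+, X s < b - 1.
  exact: (cvgr_lt _ (deriv_on_nonneg_cvg_right dX i0)).
move=> [e /= e0 he].
have [s [sT bs] se] := inf_adherent e0 hE.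
have ils : inf E <= s by apply: ge_inf; [case: hE|split].
move: ils; rewrite le_eqVlt => /predU1P[ils|ils]; first by move: bs; rewrite -ils leNgt Xi.
suff : X s < b - 1 by rewrite ltNge bs.
apply: he => //=.
by rewrite distrC ger0_norm ?subr_ge0 ?(ltW ils)// ltrBlDl.
Qed.


Lemma Im_trajectory : Y T <= y * expR ((1 + (2 - b) ^+ 2) * M * T).
Proof.
rewrite -Y0; apply: (deriv_on_nonneg_gronwall dY T0) => t t0 tT.
have Xt := Re_trajectory (ltW t0) (ltW tT).
rewrite XYE Im_gen_A// mulrC ler_pM2r// weightedP_le//; exact: ltW.
Qed.

(** From [y * |H|^2 * P = Y] and [|H| >= 1], which holds because [X T < b - 1 <= -1], follows
    [P <= Y / y]; the bound on [Y] then cancels [y]. *)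
Lemma kintP_trajectory : kintP (mu T) x y <= expR ((1 + (2 - b) ^+ 2) * M * T).
Proof.
have [_ PE _] := cauchyH_identities (mu T) x y0.
rewrite -/z -/(X T) -/(Y T) in PE.
have XT := Re_trajectory T0 (lexx T).
have YT := Im_trajectory.
have P0 := kintP_gt0 (mu T) x y0.
have h : 1 <= X T ^+ 2 + Y T ^+ 2.
  have : 0 <= Y T ^+ 2 by exact: sqr_ge0.
  move: b0; nra.
rewrite -(ler_pM2l y0); apply: le_trans YT; rewrite -{}PE.
by rewrite -mulrA ler_pM2l// ler_peMl// ltW.
Qed.

End Trajectory.

Lemma mu_bounded_below (t : R) : 0 <= t -> bounded_below (msupp (mu t)).
Proof.
move=> t0; apply/msupp_bounded_belowP.
exists ((b - 1) * expR (K * t)) => x xt; apply: quadratic_kintP.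
by exists (expR ((1 + (2 - b) ^+ 2) * M * t)) => y y0 _; exact: kintP_trajectory.
Qed.

End Flow.

(** * From the support of [tau] to those of all [mu t], and the equivalences *)

Lemma mu_bounded_below_of_tau (R : realType) (mu : R -> probability R R)
    (gamma : R) (tau : {finite_measure set R -> \bar R}) :
  associated_pair mu gamma tau -> bounded_below (msupp tau) ->
  forall t : R, 0 <= t -> bounded_below (msupp (mu t)).
Proof.
(* The flow estimates assume a nonpositive bound, and the null ray must end strictly below [b]. *)
move=> ap /msupp_bounded_belowP[b qb] t; apply: (mu_bounded_below ap (b := Num.min 0 (b - 1))).
  by rewrite ge_min lexx.
by apply: (measure_ray_eq0 qb); rewrite gt_min; apply/orP; right; lra.
Qed.

Theorem theorem6p4 (R : realType) (mu : R -> probability R R)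
    (gamma : R) (tau : {finite_measure set R -> \bar R}) :
  weakly_continuous mu ->
  monotone_semigroup mu ->
  (forall A : set R, measurable A -> mu 0 A = \d_(0 : R) A) ->
  associated_pair mu gamma tau ->
  ((exists t0 : R, 0 < t0 /\ bounded_below (msupp (mu t0))) <->
     (forall t : R, 0 <= t -> bounded_below (msupp (mu t)))) /\
  ((forall t : R, 0 <= t -> bounded_below (msupp (mu t))) <->
     bounded_below (msupp tau)).
Proof.
move=> _ sg _ ap.
(* The cycle (1) => (3) => (2) => (1) yields both equivalences. *)
have h13 t0 : 0 < t0 -> bounded_below (msupp (mu t0)) -> bounded_below (msupp tau).
  by move=> t00; exact: (tau_bounded_below sg ap t00).
have h32 := mu_bounded_below_of_tau ap.
have h21 : (forall t, 0 <= t -> bounded_below (msupp (mu t))) ->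
    exists t0, 0 < t0 /\ bounded_below (msupp (mu t0)).
  by move=> h2; exists 1; split=> //; exact: h2.
split; split => //.
- by move=> [t0 [t00 bt]]; exact/h32/(h13 t0).
- by move=> /h21[t0 [t00 bt]]; exact: (h13 t0).
Qed.
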